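(* Let $(A,\mathfrak m)$ be a nonzero commutative local ring. The ring $\mathcal T(A)$ is coherent if and only if $A$ is a field. In all cases $\mathcal T(A)$ is non-Noetherian.
   Context: All rings are commutative with identity. For a nonzero local ring $(A,\mathfrak m)$ (not necessarily Noetherian) with residue field $\kappa=A/\mathfrak m$ and residue map $a\mapsto\bar a$, define the ring, with coordinatewise operations, $$\mathcal T(A)=\{(a,(c_i)_{i\in\mathbb N})\in A\times\kappa^{\mathbb N}: c_i=\bar a\text{ for all but finitely many }i\},\quad \mathbb N=\{1,2,\ldots\}.$$ A ring is coherent if every finitely generated ideal is finitely presented. *)

(* Defs.v *)
From HB Require Import structures.
From mathcomp Require Import all_boot all_order all_algebra.
From mathcomp Require Import all_classical.

Set Implicit Arguments.
Unset Strict Implicit.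
Unset Printing Implicit Defensive.

Import GRing.Theory.

Local Open Scope classical_set_scope.
Local Open Scope quotient_scope.
Local Open Scope ring_scope.

Section FiniteModules.
Variables (R : comNzRingType) (M : lmodType R).
Implicit Type N : set M.

Definition submodule N : Prop := submod_closed (mem N).

Definition mspan n (g : 'I_n -> M) : set M :=
  [set v | exists c : 'I_n -> R, v = \sum_(i < n) c i *: g i].

Definition finitely_generated N : Prop :=
  exists n (g : 'I_n -> M), N = mspan g.

End FiniteModules.

(* A linear map R^n -> M with image N is the same thing as a linear surjection
   of R^n onto N, so this is the usual notion for the submodule N itself. *)
Definition finitely_presented (R : comNzRingType) (M : lmodType R)
    (N : set M) : Prop :=
  exists n (f : {linear 'rV[R]_n -> M}),
    range f = N /\ finitely_generated [set x | f x = 0].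

(* An ideal is a submodule of the regular module R^o. The library's [idealr]
   only covers proper ideals, so it is not used here. *)
Definition ideal (R : comNzRingType) (I : set R^o) : Prop := submodule I.

Definition coherent (R : comNzRingType) : Prop :=
  forall I : set R^o, ideal I -> finitely_generated I -> finitely_presented I.

Definition noetherian (R : comNzRingType) : Prop :=
  forall I : set R^o, ideal I -> finitely_generated I.

Definition is_field (R : comNzRingType) : Prop :=
  forall x : R, x != 0 -> exists y : R, x * y = 1.

(* Elements of [idealr A] are exactly the proper ideals of A. *)
Definition maximal_ideal (A : comNzRingType) (J : idealr A) : Prop :=
  forall K : idealr A, {subset J <= K} -> K =i J.

Definition local_ring (A : comNzRingType) (m : idealr A) : Prop :=
  maximal_ideal m /\ forall J : idealr A, maximal_ideal J -> J =i m.

Section TailRing.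
Variables (A : comNzRingType) (m : idealr A).
Local Notation kappa := {ideal_quot m}.

(* The index set {1, 2, ...} is represented by nat. *)
Definition tail_pred : {pred A * (nat -> kappa)} :=
  fun x => `[< finite_set [set i | x.2 i <> \pi_kappa x.1] >].

Lemma tail_subring_closed : subring_closed tail_pred.
Proof.
have tailP x : reflect (finite_set [set i | x.2 i <> \pi_kappa x.1])
    (x \in tail_pred) by apply: asboolP.
split.
- apply/tailP; apply: (@sub_finite_set _ _ set0) => // i /=.
  by apply; rewrite pi_oner.
- move=> x y /tailP fx /tailP fy; apply/tailP.
  apply: (@sub_finite_set _ _ (_ `|` _)) (_ : finite_set _);
    last by rewrite finite_setU; split; [exact: fx|exact: fy].
  move=> i /= xyi; apply: contrapT => /not_orP[/contrapT xi /contrapT yi].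
  by apply: xyi; rewrite raddfB /= -xi -yi.
- move=> x y /tailP fx /tailP fy; apply/tailP.
  apply: (@sub_finite_set _ _ (_ `|` _)) (_ : finite_set _);
    last by rewrite finite_setU; split; [exact: fx|exact: fy].
  move=> i /= xyi; apply: contrapT => /not_orP[/contrapT xi /contrapT yi].
  by apply: xyi; rewrite rmorphM /= -xi -yi.
Qed.

HB.instance Definition _ :=
  GRing.isSubringClosed.Build _ tail_pred tail_subring_closed.

Record tail_ring : Type :=
  TailRing { tail_val :> A * (nat -> kappa); _ : tail_val \in tail_pred }.

HB.instance Definition _ := [isSub for tail_val].
HB.instance Definition _ := [Choice of tail_ring by <:].
HB.instance Definition _ := [SubChoice_isSubComNzRing of tail_ring by <:].

End TailRing.

(* Main.v *)
From HB Require Import structures.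
Require Import Defs.
From mathcomp Require Import all_boot all_order all_algebra.
From mathcomp Require Import all_classical.
From mathcomp Require Import ring.

(* The maximal ideal consists of the nonunits. If it contains a <> 0, then the
   annihilator of (a, 0) contains every idempotent delta_i
   (1 at the i-th tail index, 0 elsewhere), while its elements have first
   coordinate in m and hence finitely supported tails. An ideal with these two
   properties is never finitely generated: all generators vanish at a common
   index. So (a, 0) generates an ideal that is not finitely presented,
   and the ideal of all elements with first coordinate in m shows that the ring
   is not Noetherian. If A is a field, the ring is von Neumann regular, so a
   finitely generated ideal is R e with e idempotent, and the kernel of
   R -> R e is R (1 - e). *)

Set Implicit Arguments.
Unset Strict Implicit.
Unset Printing Implicit Defensive.
Import GRing.Theory.
Local Open Scope classical_set_scope.
Local Open Scope quotient_scope.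
Local Open Scope ring_scope.

(** * Cyclic submodules and their annihilators *)

Section FiniteModules.
Variables (R : comNzRingType) (M : lmodType R).

Lemma mspan_gen n (g : 'I_n -> M) i : mspan g (g i).
Proof.
exists (fun j => (j == i)%:R); rewrite (bigD1 i)//= eqxx scale1r big1 ?addr0//.
by move=> j /negbTE->; rewrite scale0r.
Qed.

Lemma mspan1 (x : M) : mspan (fun _ : 'I_1 => x) = range (fun c : R => c *: x).
Proof.
apply/seteqP; split=> [v [c ->]|_ [c _ <-]].
  by exists (c ord0) => //; rewrite big_ord1.
by exists (fun=> c); rewrite big_ord1.
Qed.

Lemma submodule_cyclic (x : M) : submodule (range (fun c : R => c *: x)).
Proof.
split=> [|a u v]; first by rewrite inE; exists 0 => //; rewrite scale0r.
rewrite !inE => -[c _ <-] [d _ <-].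
by exists (a * c + d) => //; rewrite scalerDl scalerA.
Qed.

End FiniteModules.

(* If e_1, ..., e_n map to r_1 x, ..., r_n x under a presentation f and
   f u = x, then with lam v := \sum_j v_j r_j every y killing x splits as
   lam (y u) + y (1 - lam u), where y u lies in the kernel of f. *)
Lemma finitely_presented_cyclic (R : comNzRingType) (M : lmodType R) (x : M) :
  finitely_presented (range (fun c : R => c *: x)) ->
  finitely_generated [set y : R^o | (y : R) *: x = 0].
Proof.
move=> [n [f [fx [p [g kerf]]]]].
have /choice[r fr] j : exists c : R, f (delta_mx 0 j) = c *: x.
  by have : range f (f (delta_mx 0 j)) by []; rewrite fx => -[c _ <-]; exists c.
pose lam (v : 'rV[R]_n) : R := \sum_j v 0 j * r j.
have flam v : f v = lam v *: x.
  rewrite {1}[v]row_sum_delta linear_sum /= scaler_suml.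
  by apply: eq_bigr => j _; rewrite linearZ /= fr scalerA.
have lamZ a v : lam (a *: v) = a * lam v.
  by rewrite /lam mulr_sumr; apply: eq_bigr => j _; rewrite !mxE mulrA.
have lam_sum (c : 'I_p -> R) : lam (\sum_i c i *: g i) = \sum_i c i * lam (g i).
  rewrite /lam; under eq_bigr do rewrite summxE mulr_suml.
  rewrite exchange_big /=; apply: eq_bigr => i _.
  by rewrite mulr_sumr; apply: eq_bigr => j _; rewrite mxE mulrA.
have [u _ fu] : range f x by rewrite fx; exists 1 => //; rewrite scale1r.
exists p.+1,
  (fun k => if unlift ord0 k is Some i then lam (g i) else 1 - lam u).
apply/seteqP; split=> y.
  move=> /= yx0.
  have : [set v | f v = 0] (y *: u) by rewrite /= linearZ /= fu.
  rewrite kerf => -[c yu].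
  exists (fun k => if unlift ord0 k is Some i then c i else y).
  rewrite big_ord_recl unlift_none; under eq_bigr do rewrite !liftK.
  transitivity (y * (1 - lam u) + lam (y *: u)); last by rewrite yu lam_sum.
  by rewrite lamZ mulrBr mulr1 subrK.
(* Conversely, each generator kills [x]: [(1 - lam u) *: x = x - f u = 0] and
   [lam (g i) *: x = f (g i) = 0]. *)
move=> [c ->] /=; rewrite big_ord_recl unlift_none.
under eq_bigr do rewrite !liftK.
rewrite scalerDl -[c ord0 *: _]/(_ * _) -scalerA scalerBl -flam fu scale1r.
rewrite subrr scaler0 add0r scaler_suml big1// => i _.
rewrite -[X in X *: x]/(c (lift ord0 i) * lam (g i)) -scalerA -flam.
have : mspan g (g i) by exact: mspan_gen.
by rewrite -kerf /= => ->; rewrite scaler0.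
Qed.

(** * Coherence of von Neumann regular rings *)

Section Regular.
Variable R : comNzRingType.
Hypothesis regularR : forall x : R, exists y, x * y * x = x.

(** Induction on the number of generators. If all but the first generator [a] span [R e], then
    [z = a (1 - e)] is orthogonal to [e], and [a], [e] span the same ideal as [z], [e]. With
    [z y z = z], the idempotent [z y] generates [R z] and is orthogonal to [e], so [e + z y]
    generates the sum. *)
Lemma regular_mspan_idempotent n (g : 'I_n -> R^o) :
  exists e : R, e * e = e /\ mspan g = range (fun c : R => c *: (e : R^o)).
Proof.
elim: n g => [|n IHn] g.
  exists 0; split; first by rewrite mulr0.
  apply/seteqP; split=> [v [c ->]|_ [c _ <-]].
    by exists 0 => //; rewrite big_ord0 scale0r.
  by exists (fun=> 0); rewrite big_ord0 scaler0.
have [e [ee ge]] := IHn (fun i => g (lift ord0 i)).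
pose a : R := g ord0; pose z := a * (1 - e).
have ze : z * e = 0 by rewrite -mulrA mulrBl mul1r ee subrr mulr0.
have [y zyz] := regularR z.
have spanE v : mspan g v <-> exists b c : R, v = b * a + c * e.
  split=> [[c ->]|[b [c ->]]].
    rewrite big_ord_recl.
    have : mspan (fun i => g (lift ord0 i))
        (\sum_(i < n) c (lift ord0 i) *: g (lift ord0 i)).
      by exists (fun i => c (lift ord0 i)).
    by rewrite ge => -[d _ <-]; exists (c ord0), d.
  have : range (fun c : R => c *: (e : R^o)) (c * e) by exists c.
  rewrite -ge => -[d ->].
  exists (fun k => if unlift ord0 k is Some i then d i else b).
  by rewrite big_ord_recl unlift_none; under [in RHS]eq_bigr do rewrite liftK.
have ez : e * z = 0 by rewrite mulrC.
have e'e' : (e + z * y) * (e + z * y) = e + z * y.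
  transitivity (e * e + z * e * y *+ 2 + z * y * z * y); first by ring.
  by rewrite ee ze mul0r mul0rn addr0 zyz.
have ee' : e * (e + z * y) = e.
  transitivity (e * e + z * e * y); first by ring.
  by rewrite ee ze mul0r addr0.
have zz' : z * (e + z * y) = z.
  transitivity (z * e + z * y * z); first by ring.
  by rewrite ze zyz add0r.
exists (e + z * y); split=> //; apply/seteqP; split=> v.
  (* Since [a = a * e + z], this coefficient is [v] itself; multiplication by [e + z * y] fixes both
     [e] and [z]. *)
  move=> /spanE[b [c ->]]; exists (b * (a * e + z) + c * e) => //.
  transitivity (b * (a * (e * (e + z * y)) + z * (e + z * y))
                + c * (e * (e + z * y))); last by rewrite ee' zz' /z; ring.
  by rewrite -[LHS]/(_ * _); ring.
move=> [c _ <-]; apply/spanE; exists (c * y * (1 - e)), c.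
by rewrite -[LHS]/(_ * _) /z; ring.
Qed.

Lemma regular_coherent : coherent R.
Proof.
move=> I _ [n [g ->]]; have [e [ee ->]] := regular_mspan_idempotent g.
pose f (v : 'rV[R]_1) : R^o := v 0 0 *: (e : R^o).
have f_lin : linear f.
  by move=> a u v; rewrite /f !mxE scalerDl -scalerA.
pose F : {linear 'rV[R]_1 -> R^o} :=
  HB.pack f (GRing.isLinear.Build _ _ _ _ f f_lin).
exists 1%N, F; split.
  apply/seteqP; split=> [_ [v _ <-]|_ [c _ <-]]; first by exists (v 0 0).
  by exists (const_mx c) => //=; rewrite /f mxE.
exists 1%N, (fun=> const_mx (1 - e)); rewrite mspan1.
apply/seteqP; split=> [v /= ve|_ [c _ <-]] /=.
  exists (v 0 0) => //; apply/rowP => j; rewrite !mxE ord1 mulrBr mulr1.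
  by rewrite -[X in _ - X]/(f v) ve subr0.
by rewrite /f !mxE -[LHS]/(_ * _) -mulrA mulrBl mul1r ee subrr mulr0.
Qed.

End Regular.

(** * Nonunits and maximal ideals *)

(** Zorn's lemma is applied to sets that are closed under [a * u + v] and avoid 1. That they contain
    [b] is encoded as stability under adding multiples of [b]. *)
Lemma nonunit_in_maximal_ideal (A : comNzRingType) (b : A) :
  (forall c, b * c <> 1) -> exists2 J : idealr A, maximal_ideal J & b \in J.
Proof.
move=> bN.
(* The empty set satisfies P, as Zorn_bigcup requires for the empty chain. *)
pose P (X : set A) := [/\ forall a u v, X u -> X v -> X (a * u + v),
  forall u c, X u -> X (u + c * b) & ~ X 1].
have [F FP Ftot|M [[MD Mb M1] Mmax]] := @Zorn_bigcup _ P.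
  split=> [a u v [X FX Xu] [Y FY Yv]|u c [X FX Xu]|[X FX]].
  - by have [XY|YX] := Ftot _ _ FX FY;
      [exists Y => //; case: (FP _ FY) => + _ _; apply => //; exact: XY
      |exists X => //; case: (FP _ FX) => + _ _; apply => //; exact: YX].
  - by exists X => //; case: (FP _ FX) => _ + _; apply.
  - by case: (FP _ FX).
have Mmax' X : M `<=` X -> P X -> X `<=` M.
  by move=> MX PX; apply: contrapT => XM; exact: (Mmax X).
(* Without 0 the maximal [M] would be empty, as [-1 * u + u = 0]. But the multiples of [b] satisfy
   [P], the nonunit hypothesis keeping 1 out, so they would lie in [M]. *)
have M0 : M 0.
  have M_sub0 u : M u -> M 0.
    by move=> Mu; have := MD (-1) _ _ Mu Mu; rewrite mulN1r addNr.
  apply: contrapT => nM0; apply: (nM0).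
  apply: (Mmax' (range (fun c => c * b))).
  - by move=> u Mu; case: nM0; exact: (M_sub0 u).
  - split=> [a _ _ [c _ <-] [d _ <-]|_ c [d _ <-]|[c _]].
    + by exists (a * c + d) => //; ring.
    + by exists (d + c) => //; ring.
    + by rewrite mulrC; exact: bN.
  - by exists 0 => //; rewrite mul0r.
have {}Mb : M b by have := Mb 0 1 M0; rewrite add0r mul1r.
pose S : {pred A} := fun x => `[< M x >].
have SE x : x \in S <-> M x by split => /asboolP.
have S_idealr : idealr_closed S.
  split; [exact/SE|exact/negP/SE|].
  by move=> a u v /SE Mu /SE Mv; apply/SE; exact: MD.
pose J : idealr A := HB.pack S (isIdealr.Build A S S_idealr).
exists J; last exact/SE.
(* A proper ideal [K] above [J] contains [b], hence satisfies [P], and the maximality of [M]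
   applies. *)
move=> K JK x; apply/idP/idP => [xK|]; last exact: JK.
apply/SE; apply: (Mmax' [set y | y \in K]) => //=.
  by move=> y /SE; exact: JK.
split=> /= [a u v uK vK|u c uK|]; last by rewrite idealr1.
  by rewrite rpredD // idealMr.
by rewrite rpredD // idealMr // JK //; exact/SE.
Qed.

Lemma nonunit_in_local_ideal (A : comNzRingType) (m : idealr A) (b : A) :
  local_ring m -> (forall c, b * c <> 1) -> b \in m.
Proof. by move=> [_ m_uniq] /nonunit_in_maximal_ideal[J /m_uniq<-]. Qed.

(** * The tail ring: finite supports, regularity and coherence *)

Section TailRing.
Variables (A : comNzRingType) (m : idealr A).
Local Notation kappa := {ideal_quot m}.

Lemma pi_quot_eq0 (a : A) : (\pi_kappa a == 0) = (a \in m).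
Proof.
by rewrite -[X in _ == X](raddf0 \pi_kappa) -Quotient.idealrBE subr0.
Qed.

Lemma tail_pred_finite_supportP (c : nat -> kappa) (a : A) : a \in m ->
  reflect (finite_set [set i | c i <> 0]) ((a, c) \in @tail_pred A m).
Proof.
by rewrite -pi_quot_eq0 => /eqP a0; apply: (iffP (asboolP _)) => /=; rewrite a0.
Qed.

Lemma tail_delta_subproof i :
  (0 : A, fun j : nat => (j == i)%:R : kappa) \in @tail_pred A m.
Proof.
apply/tail_pred_finite_supportP; first exact: rpred0.
apply: (@sub_finite_set _ _ [set i]) => // j /= ji.
by apply: contrapT => /eqP/negbTE nji; apply: ji; rewrite nji.
Qed.

Definition tail_delta i : tail_ring m := TailRing (tail_delta_subproof i).

Lemma finite_tails_not_finitely_generated (N : set (tail_ring m)^o) :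
  (forall x, N x -> (val (x : tail_ring m)).1 \in m) ->
  (forall i, N (tail_delta i)) -> ~ finitely_generated N.
Proof.
move=> Nm Nd [n [g Ng]].
pose ev i (x : tail_ring m) : kappa := (val x).2 i.
have fin_supp :
    finite_set (\bigcup_(j in [set: 'I_n]) [set i | ev i (g j) <> 0]).
  apply: bigcup_finite => // j _.
  apply/(@tail_pred_finite_supportP _ (val (g j)).1).
    by apply: Nm; rewrite Ng; exact: mspan_gen.
  by rewrite -surjective_pairing; exact: valP.
have [i gi] : exists i, forall j, ev i (g j) = 0.
  have /infinite_setN0[i Si] := infinite_setD infinite_nat fin_supp.
  exists i => j.
  by apply: contrapT => gji; case: Si => _; apply; exists j.
(* Evaluation at [i] kills every combination of the generators but sends [tail_delta i] to 1. *)
have := Nd i; rewrite Ng => -[c /(congr1 (ev i))].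
rewrite (big_morph (ev i) (id1 := 0) (op1 := +%R))//.
rewrite big1 => [|j _]; last first.
  by rewrite -[LHS]/(ev i (c j) * ev i (g j)) gi mulr0.
by rewrite /ev /= eqxx => /eqP; rewrite oner_eq0.
Qed.

Lemma tail_ring_not_noetherian : ~ noetherian (tail_ring m).
Proof.
move=> noeth.
pose N : set (tail_ring m)^o := [set x | (val (x : tail_ring m)).1 \in m].
apply: (@finite_tails_not_finitely_generated N) => //.
  by move=> i /=; exact: rpred0.
apply: noeth; split=> [|a u v]; rewrite !inE /N /=; first exact: rpred0.
by move=> um vm; rewrite rpredD // idealMr.
Qed.

Lemma tail_ring_field_regular : is_field A ->
  forall x : tail_ring m, exists y, x * y * x = x.
Proof.
move=> fieldA.
have m0 a : a \in m -> a = 0.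
  move=> am; apply: contrapT => /eqP/fieldA[c ac].
  by have := idealr1 m; rewrite -ac mulrC idealMr.
have pi_inj (a b : A) : \pi_kappa a = \pi_kappa b -> a = b.
  move/eqP; rewrite -Quotient.idealrBE => /m0/eqP.
  by rewrite subr_eq0 => /eqP.
have /choice[inv invP] (a : A) : exists b, a * b * a = a.
  have [->|/fieldA[b ab]] := eqVneq a 0; first by exists 0; rewrite mulr0.
  by exists b; rewrite ab mul1r.
move=> [[a c] ac].
(* Quasi-inverses are taken coordinatewise through representatives. Wherever [c i] is the residue of
   [a], injectivity of the residue map gives [repr (c i) = a], so the new tail agrees there with the
   residue of [inv a]. *)
have yP : (inv a, fun i => \pi_kappa (inv (repr (c i)))) \in @tail_pred A m.
  apply/asboolP; move/asboolP: ac; apply: sub_finite_set => i /=.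
  apply: contra_not => ci; rewrite ci; congr (\pi_kappa (inv _)).
  by apply: pi_inj; rewrite reprK.
exists (TailRing yP); apply: val_inj; congr (_, _); first exact: invP.
apply/funext => i; rewrite -[LHS]/(c i * \pi_kappa (inv (repr (c i))) * c i) /=.
have {1 3 4}<- : \pi_kappa (repr (c i)) = c i by exact: reprK.
by rewrite -!rmorphM invP.
Qed.

Lemma coherent_tail_ring_field :
  local_ring m -> coherent (tail_ring m) -> is_field A.
Proof.
move=> locm coh a a0; apply: contrapT => aN.
have am : a \in m.
  by apply: nonunit_in_local_ideal => // c ac; apply: aN; exists c.
have tP : (a, fun=> 0 : kappa) \in @tail_pred A m.
  by apply/tail_pred_finite_supportP => //; apply: (@sub_finite_set _ _ set0).
pose t : (tail_ring m)^o := TailRing tP.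
have /finitely_presented_cyclic :
    finitely_presented (range (fun c : tail_ring m => c *: t)).
  apply: coh; first exact: submodule_cyclic.
  by exists 1%N, (fun=> t); rewrite mspan1.
apply: finite_tails_not_finitely_generated => [x /= xt0|i /=].
  have /= xa0 := congr1 (fun y : tail_ring m => (val y).1) xt0.
  (* If the first coordinate of [x] had an inverse [c], then [x * t = 0] would force [a = 0]. *)
  apply: nonunit_in_local_ideal => // c xc; move/eqP: a0; apply.
  by rewrite -[a]mul1r -xc mulrAC xa0 mul0r.
apply: val_inj; congr (_, _); first by rewrite /= mul0r.
by apply/funext => j; rewrite /= mulr0.
Qed.

End TailRing.

Theorem theorem6p1 (A : comNzRingType) (m : idealr A) (Hm : local_ring m) :
  (coherent (tail_ring m) <-> is_field A) /\ ~ noetherian (tail_ring m).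
Proof.
split; last exact: tail_ring_not_noetherian.
split; first exact: coherent_tail_ring_field.
by move=> fieldA; apply: regular_coherent; exact: tail_ring_field_regular.
Qed.
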